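(* Let $S\subset\mathbb{R}^2$ be a Minkowski-centered triangle. The diagram $f_{\mathrm{MAX}}(\bar{\mathcal{C}}^2,S)$ is fully described by the inequalities $$\frac{D_{\mathrm{MAX}}(K,S)}{2}\le R(K,S),\qquad r(K,S)\le \frac{D_{\mathrm{MAX}}(K,S)}{2},\qquad 0\le r(K,S),\qquad R(K,S)\le D_{\mathrm{MAX}}(K,S),$$ $$\left(\frac{D_{\mathrm{MAX}}(K,S)}{R(K,S)}-\frac12\right)\left(\frac32-\frac{D_{\mathrm{MAX}}(K,S)}{R(K,S)}\right)\le\frac{r(K,S)}{R(K,S)}.$$ That is, $$f_{\mathrm{MAX}}(\bar{\mathcal{C}}^2,S)=\left\{(x,y)\in\mathbb{R}^2:\ y\le 1,\ x\le y,\ 0\le x,\ 1\le 2y,\ \left(2y-\tfrac12\right)\left(\tfrac32-2y\right)\le x\right\}.$$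
   Context: A convex body is a nonempty compact convex set. $\bar{\mathcal{C}}^2$ is the family of convex bodies in $\mathbb{R}^2$ that are not single points. For a convex body $C$, $h_C(a)=\max_{x\in C}a^Tx$ is the support function. For convex bodies $K,C$: the circumradius is $R(K,C)=\inf\{\rho\ge0:\exists t,\ K\subset t+\rho C\}$ and the inradius is $r(K,C)=\sup\{\rho\ge0:\exists t,\ t+\rho C\subset K\}$. The Minkowski asymmetry is $s(C)=R(C,-C)$, and $C$ is Minkowski-centered if $C\subset -s(C)C$. (Triangles are understood to be full-dimensional.) The maximum diameter is $$D_{\mathrm{MAX}}(K,C)=\max_{u\in\mathbb{R}^2\setminus\{0\}}\frac{h_K(u)+h_K(-u)}{\max(h_C(u),h_C(-u))}.$$ For $K\in\bar{\mathcal{C}}^2$, $f_{\mathrm{MAX}}(K,C)=\left(\frac{r(K,C)}{R(K,C)},\frac{D_{\mathrm{MAX}}(K,C)}{2R(K,C)}\right)$, and $f_{\mathrm{MAX}}(\bar{\mathcal{C}}^2,C)=\{f_{\mathrm{MAX}}(K,C):K\in\bar{\mathcal{C}}^2\}$ is the Blaschke-Santaló diagram. ''Fully described'' by inequalities means that every $K$ satisfies them and every pair of values satisfying them is attained by some $K$. *)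

(* Defs.v *)
From HB Require Import structures.
From mathcomp Require Import all_boot all_order all_algebra.
From mathcomp Require Import all_classical all_reals all_analysis.
Set Implicit Arguments.
Unset Strict Implicit.
Unset Printing Implicit Defensive.
Import Order.TTheory GRing.Theory Num.Theory.
Import numFieldNormedType.Exports.
Local Open Scope classical_set_scope.
Local Open Scope ring_scope.

Section ConvexBodies.
Variable R : realType.
Implicit Types (K C : set 'rV[R]_2) (t u x : 'rV[R]_2) (rho : R).

Definition convex_body C := [/\ C !=set0, compact C & convex_set C].

Definition nontrivial_convex_body C :=
  convex_body C /\ forall p, C <> [set p].

Definition dot u x : R := (u *m x^T) 0 0.

(* On a convex body the supremum is attained, so it is the maximum. *)
Definition support_function C u : R := sup [set dot u x | x in C].

(* [homothet t rho C] is t + rho C; [rho] may be negative. *)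
Definition homothet t rho C : set 'rV[R]_2 := [set t + rho *: x | x in C].

(* [inf] and [sup] on [R] return 0 on the empty set and on unbounded sets.
   For convex bodies this affects [circumradius K C] only if no homothet of
   [C] covers [K], and [inradius K C] only if [C] is a point; neither occurs
   when [C] is a triangle, nor for [circumradius C (homothet 0 (-1) C)]. *)
Definition circumradius K C : R :=
  inf [set rho | 0 <= rho /\ exists t, K `<=` homothet t rho C].

Definition inradius K C : R :=
  sup [set rho | 0 <= rho /\ exists t, homothet t rho C `<=` K].

Definition minkowski_asymmetry C : R := circumradius C (homothet 0 (-1) C).

Definition minkowski_centered C :=
  C `<=` homothet 0 (- minkowski_asymmetry C) C.

(* The denominator is positive for u != 0 as soon as 0 is interior to [C],
   e.g. for a Minkowski-centered triangle; the quotient is then a continuous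
   function of the direction of u and the supremum is attained. *)
Definition diameter_max K C : R :=
  sup [set (support_function K u + support_function K (- u)) /
           Num.max (support_function C u) (support_function C (- u))
      | u in [set u | u != 0]].

Definition convex_hull (A : set 'rV[R]_2) : set 'rV[R]_2 :=
  smallest (@convex_set R 'rV[R]_2) A.

(* [row_free] says that the two edge vectors at [a] are linearly independent,
   i.e. that the three vertices are affinely independent. *)
Definition triangle C := exists a b c : 'rV[R]_2,
  row_free (col_mx (b - a) (c - a)) /\ C = convex_hull [set a; b; c].

Definition f_max C K : R * R :=
  (inradius K C / circumradius K C,
   diameter_max K C / (2 * circumradius K C)).

Definition max_diagram C : set (R * R) :=
  [set f_max C K | K in nontrivial_convex_body].

End ConvexBodies.

(* Main.v *)
Require Import Defs.
From HB Require Import structures.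
From mathcomp Require Import all_boot all_order all_algebra.
From mathcomp Require Import all_classical all_reals all_analysis.
From mathcomp Require Import ring lra.
Set Implicit Arguments.
Unset Strict Implicit.
Unset Printing Implicit Defensive.
Import Order.TTheory GRing.Theory Num.Theory.
Import numFieldNormedType.Exports.
Local Open Scope classical_set_scope.
Local Open Scope ring_scope.

(** Everything is read off in barycentric coordinates p1, p2, p3 of the
    triangle. A Minkowski-centered triangle has its centroid at 0
    ([centered_frame_exists]), and the three functionals become explicit:
    the circumradius of K is determined by the minima of the p_i on K
    ([circumradiusE]); the maximum diameter is the largest oscillation on K of
    a difference p_i - p_j ([diameter_le], [diameter_spread]), because the
    functional max(h_S(u), h_S(-u)) is the support function of the hexagon
    conv(S, -S), whose edges are normal to these differences; the inradius is
    bounded below by exhibiting homothetic copies and above by testing their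
    vertices.

    The first three inequalities follow by comparing widths. For the other
    two, normalize R = 1 and translate K so that S is the smallest copy of the
    triangle around K. Its sides touch K in three points (0, 1-a, a),
    (b, 0, 1-b), (1-c, c, 0), and the triangle they span contains a homothetic
    copy of S of ratio
      f = 1 - (a+b+c) + (ab+bc+ca) = abc + (1-a)(1-b)(1-c)
    ([inscribed_homothet]). Comparing the touching points pairwise gives
    D >= 1 + max(b-a, c-b, a-c) >= 1. Since f equals
    1/4 + (a+b+c-3/2)^2/3 - ((b-a)^2+(c-b)^2+(a-c)^2)/6 and three numbers of
    sum zero that are at most e have sum of squares at most 6e^2, it follows
    that f >= 1/4 - (D-1)^2, which is the last inequality.

    Conversely, fix D = 1 + d. A family of polygons K_l, for l in [0, 1], with
    constraints affine in l, keeps R = 1 and D = 1 + d. It starts at a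
    polygon of inradius f, which is 1/4 - d^2 or 0 for suitable a, b, c, hence
    the lower boundary of the diagram, and ends at a polygon of inradius at
    least D/2, the upper boundary. Since (1-s) K_0 + s K_m lies in K_(sm), the
    inradius g satisfies s g(m) <= g(sm), so g has no upward jumps; together
    with the bound g(l) <= f + 3l this makes g attain all intermediate values
    ([star_intermediate_value]). *)

(** * Linear forms and convex combinations *)

Section DotProduct.
Variable R : realType.
Implicit Types u v x y : 'rV[R]_2.

Lemma dotDr u x y : dot u (x + y) = dot u x + dot u y.
Proof. by rewrite /dot linearD mulmxDr mxE. Qed.

Lemma dotZr u (k : R) x : dot u (k *: x) = k * dot u x.
Proof. by rewrite /dot linearZ -scalemxAr mxE. Qed.

Lemma dotNr u x : dot u (- x) = - dot u x.
Proof. by rewrite /dot linearN mulmxN mxE. Qed.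

Lemma dotDl u v x : dot (u + v) x = dot u x + dot v x.
Proof. by rewrite /dot mulmxDl mxE. Qed.

Lemma dotZl (k : R) u x : dot (k *: u) x = k * dot u x.
Proof. by rewrite /dot -scalemxAl mxE. Qed.

Lemma dotNl u x : dot (- u) x = - dot u x.
Proof. by rewrite /dot mulNmx mxE. Qed.

Lemma dot0l x : dot 0 x = 0 :> R.
Proof. by rewrite /dot mul0mx mxE. Qed.

Lemma dot0r u : dot u 0 = 0 :> R.
Proof. by rewrite /dot linear0 mulmx0 mxE. Qed.

Definition dotE := (dotDr, dotZr, dotNr, dot0r, dotDl, dotZl, dotNl, dot0l).

Lemma dot_eq0 u : (forall x, dot u x = 0) -> u = 0.
Proof.
move=> u0; apply/rowP => i; rewrite mxE -(u0 (delta_mx 0 i)) /dot.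
rewrite trmx_delta mxE (bigD1 i)//= big1 => [|j ji].
  by rewrite mxE !eqxx mulr1 addr0.
by rewrite mxE (negPf ji) mulr0.
Qed.

Lemma dot_continuous u : continuous (dot u).
Proof.
have -> : dot u = (fun x => u 0 0 * x 0 0 + u 0 1 * x 0 1).
  apply/funext => x; rewrite /dot mxE !big_ord_recl big_ord0 addr0 !mxE.
  by rewrite (_ : lift 0 0 = 1 :> 'I_2)//; apply/val_inj.
have cc i : continuous (fun x : 'rV[R]_2 => u 0 i * x 0 i).
  by move=> x; exact: (continuous_comp (@coord_continuous _ 1 2 0 i x)
    (@mulrl_continuous R _ _)).
by move=> x; exact: (continuousD (cc _ x) (cc _ x)).
Qed.

End DotProduct.

Section Convexity.
Variable R : realType.
Implicit Types A C K : set 'rV[R]_2.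

Lemma convex_setP A : convex_set A <->
  forall x y (k : R), 0 <= k <= 1 -> A x -> A y -> A (k *: x + (1 - k) *: y).
Proof.
split=> [cA x y k /andP[k0 k1] Ax Ay|cA x y k /set_mem Ax /set_mem Ay].
  have k01 : Itv.spec (@Itv.num_sem R) (Itv.Real `[0%Z, 1%Z]) k.
    by rewrite /= /Itv.num_sem num_real/= in_itv /= k0 k1.
  have := cA x y (Itv.mk k01) (mem_set Ax) (mem_set Ay).
  by rewrite inE.
by apply/mem_set; apply: cA => //; rewrite ge0 le1.
Qed.

(** Associativity: two of the points are averaged first. The formula for the
    inner weights needs the third weight to differ from 1. *)
Lemma convex_set_comb3 A x y z (p q r : R) : convex_set A ->
  0 <= p -> 0 <= q -> 0 <= r -> p + q + r = 1 ->
  A x -> A y -> A z -> A (p *: x + q *: y + r *: z).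
Proof.
move=> /convex_setP cA p0 q0 r0 pqr Ax Ay Az.
have [r1|r1] := eqVneq r 1.
  have [-> ->] : p = 0 /\ q = 0 by split; lra.
  by rewrite r1 !scale0r !add0r scale1r.
have s0 : 0 < 1 - r by rewrite subr_gt0 lt_neqAle r1 /=; lra.
have -> : p *: x + q *: y + r *: z =
    (1 - r) *: ((p / (1 - r)) *: x + (1 - p / (1 - r)) *: y)
      + (1 - (1 - r)) *: z.
  rewrite scalerDr !scalerA; congr (_ *: _ + _ *: _ + _ *: _).
  - by field; apply: lt0r_neq0.
  - have -> : q = 1 - r - p by lra.
    by field; apply: lt0r_neq0.
  - by ring.
apply: (cA) => //; first by apply/andP; split; lra.
apply: cA => //; rewrite divr_ge0 ?(ltW s0)//= ler_pdivrMr//; lra.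
Qed.

End Convexity.

(** * The barycentric frame of a centered triangle *)

(** The normals are dual to the vertices up to the constant 1/3 (the
    barycentric coordinate of the centroid 0), so that the barycentric
    coordinates of x are [dot normal_i x + 1/3]. *)
Record centered_frame (R : realType) (S : set 'rV[R]_2) := CenteredFrame {
  vertex1 : 'rV[R]_2; vertex2 : 'rV[R]_2; vertex3 : 'rV[R]_2;
  normal1 : 'rV[R]_2; normal2 : 'rV[R]_2; normal3 : 'rV[R]_2;
  normals_sum : normal1 + normal2 + normal3 = 0;
  vertices_sum : vertex1 + vertex2 + vertex3 = 0;
  expansion : forall x, x =
    dot normal1 x *: vertex1 + dot normal2 x *: vertex2
      + dot normal3 x *: vertex3;
  dual1 : [/\ dot normal1 vertex1 = 2 / 3, dot normal1 vertex2 = - (1 / 3) &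
              dot normal1 vertex3 = - (1 / 3)];
  dual2 : [/\ dot normal2 vertex1 = - (1 / 3), dot normal2 vertex2 = 2 / 3 &
              dot normal2 vertex3 = - (1 / 3)];
  dual3 : [/\ dot normal3 vertex1 = - (1 / 3), dot normal3 vertex2 = - (1 / 3) &
              dot normal3 vertex3 = 2 / 3];
  mem_frame : forall x,
    S x <-> [/\ - (1 / 3) <= dot normal1 x, - (1 / 3) <= dot normal2 x &
                - (1 / 3) <= dot normal3 x] }.

Section FrameExistence.
Variable R : realType.
Implicit Types a b c x : 'rV[R]_2.

(** The forms are the columns of the inverse of the matrix of edge vectors. *)
Lemma dual_basis a b c : row_free (col_mx (b - a) (c - a)) ->
  exists p q : 'rV[R]_2,
  [/\ dot p (b - a) = 1, dot p (c - a) = 0, dot q (b - a) = 0,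
      dot q (c - a) = 1 &
      forall x, x = dot p x *: (b - a) + dot q x *: (c - a)].
Proof.
set M : 'M[R]_2 := col_mx (b - a) (c - a).
rewrite (row_free_unit M) => Mu.
pose w (x : 'rV[R]_2) : 'rV[R]_(1 + 1) := x *m invmx M.
pose p : 'rV[R]_2 := (col (lshift 1 0) (invmx M : 'M[R]_(2, 1 + 1)))^T.
pose q : 'rV[R]_2 := (col (rshift 1 0) (invmx M : 'M[R]_(2, 1 + 1)))^T.
have pE x : dot p x = w x 0 (lshift 1 0).
  by rewrite /dot -trmx_mul mxE /w !mxE; apply: eq_bigr => i _; rewrite !mxE.
have qE x : dot q x = w x 0 (rshift 1 0).
  by rewrite /dot -trmx_mul mxE /w !mxE; apply: eq_bigr => i _; rewrite !mxE.
have ex x : x = dot p x *: (b - a) + dot q x *: (c - a).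
  have xE : x = w x *m col_mx (b - a) (c - a) by rewrite /w mulmxKV.
  rewrite {1}xE -{1}(hsubmxK (w x)) mul_row_col pE qE.
  by rewrite [lsubmx _]mx11_scalar [rsubmx _]mx11_scalar !mul_scalar_mx !mxE.
have free (k l : R) : k *: (b - a) + l *: (c - a) = 0 -> k = 0 /\ l = 0.
  move=> kl; have : row_mx (k%:M : 'M[R]_1) (l%:M : 'M[R]_1) *m M = 0.
    by rewrite mul_row_col !mul_scalar_mx.
  move=> /(congr1 (mulmx^~ (invmx M))); rewrite mul0mx mulmxK//.
  rewrite -[RHS]/(0 : 'M[R]_(1, 1 + 1)) -row_mx0 => kl0.
  have entry (A B : 'M[R]_1) : A = B -> A 0 0 = B 0 0 by move->.
  have [/entry + /entry] := @eq_row_mx _ 1 1 1 _ _ _ _ kl0.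
  by rewrite !mxE eqxx !mulr1n.
exists p, q.
have [] := free (dot p (b - a) - 1) (dot q (b - a)).
  by rewrite scalerBl scale1r addrAC -ex subrr.
have [] := free (dot p (c - a)) (dot q (c - a) - 1).
  by rewrite scalerBl scale1r addrA -ex subrr.
by move=> -> /eqP + /eqP + ->; rewrite !subr_eq0 => /eqP -> /eqP ->.
Qed.

(** Here the position of the origin is still arbitrary: its barycentric
    coordinates are the constants [k1], [k2], [k3]. *)
Lemma triangle_barycentric (S : set 'rV[R]_2) : triangle S ->
  exists v1 v2 v3 n1 n2 n3 : 'rV[R]_2, exists k1 k2 k3 : R,
  [/\ n1 + n2 + n3 = 0, k1 + k2 + k3 = 1,
      forall x, x = (dot n1 x + k1) *: v1 + (dot n2 x + k2) *: v2
                    + (dot n3 x + k3) *: v3,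
      [/\ [/\ dot n1 v1 + k1 = 1, dot n1 v2 + k1 = 0 & dot n1 v3 + k1 = 0],
          [/\ dot n2 v1 + k2 = 0, dot n2 v2 + k2 = 1 & dot n2 v3 + k2 = 0] &
          [/\ dot n3 v1 + k3 = 0, dot n3 v2 + k3 = 0 & dot n3 v3 + k3 = 1]] &
      forall x, S x <-> [/\ 0 <= dot n1 x + k1, 0 <= dot n2 x + k2 &
                            0 <= dot n3 x + k3]].
Proof.
move=> [a [b [c [/dual_basis[p [q [pb pc qb qc ex]]] SE]]]].
move: pb pc qb qc; rewrite !dotE => pb pc qb qc.
exists a, b, c, (- p - q), p, q, (1 + dot p a + dot q a),
  (- dot p a), (- dot q a).
have exa x : x = (dot (- p - q) x + (1 + dot p a + dot q a)) *: a +
    (dot p x - dot p a) *: b + (dot q x - dot q a) *: c.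
  rewrite -{1}[x](subrK a) {1}[x - a]ex !dotE.
  rewrite [X in X *: a](_ : _ = 1 - (dot p x - dot p a) - (dot q x - dot q a));
    last by ring.
  rewrite !scalerBr !scalerBl scale1r.
  set P := dot p x *: _; set Q := dot q x *: _.
  by apply/rowP => i; rewrite !mxE; ring.
split.
- by rewrite addrAC subrK addNr.
- by ring.
- exact: exa.
- by split; split; rewrite ?dotE; lra.
- move=> x; rewrite SE; split; last first.
    move=> [x1 x2 x3] A [cA subA]; rewrite [x]exa.
    apply: convex_set_comb3 => //.
    + by rewrite !dotE; ring.
    + by apply: subA; left; left.
    + by apply: subA; left; right.
    + by apply: subA; right.
  apply: (@smallest_sub _ (@convex_set R 'rV[R]_2) [set a; b; c]
    [set x | [/\ 0 <= dot (- p - q) x + (1 + dot p a + dot q a),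
       0 <= dot p x - dot p a & 0 <= dot q x - dot q a]]).
    apply/convex_setP => y z k /andP[k0 k1] [y1 y2 y3] [z1 z2 z3].
    by move: y1 y2 y3 z1 z2 z3; rewrite /= !dotE; split; nra.
  by move=> y /= [[]|] ->; rewrite !dotE; split; lra.
Qed.

End FrameExistence.

Section CenteredFrame.
Variable R : realType.

(** Every triangle S satisfies S <= t - 2 S for t the sum of its vertices, so
    the asymmetry s is at most 2. Conversely S <= - s S, evaluated at the i-th
    vertex in the i-th barycentric coordinate k_i of the origin, gives
    1 <= (1 + s) k_i; summing, s >= 2, and then every k_i is 1/3. *)
Lemma centered_frame_exists (S : set 'rV[R]_2) :
  triangle S -> minkowski_centered S -> inhabited (centered_frame S).
Proof.
move=> /triangle_barycentric
  [w1 [w2 [w3 [m1 [m2 [m3 [k1 [k2 [k3 [msum ksum ex [d1 d2 d3] memS]]]]]]]]]].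
move=> centered; set s := minkowski_asymmetry S in centered *.
case: d1 d2 d3 => d11 d12 d13 [d21 d22 d23] [d31 d32 d33].
have s_ge0 : 0 <= s.
  have [A0|A0] := pselect ([set rho | 0 <= rho /\
      exists t, S `<=` homothet t rho (homothet 0 (-1) S)] !=set0).
    by apply: lb_le_inf => // x [].
  rewrite /s /minkowski_asymmetry /circumradius.
  by move/nonemptyPn: A0 => ->; rewrite inf0.
have s_le2 : s <= 2.
  apply: ge_inf; first by exists 0 => x [].
  split=> //; exists (w1 + w2 + w3) => x /memS[x1 x2 x3].
  exists (0 + (-1) *: ((1 / 2) *: (w1 + w2 + w3 - x))).
    exists ((1 / 2) *: (w1 + w2 + w3 - x)) => //.
    have xs : dot m1 x + dot m2 x + dot m3 x = 0.
      by rewrite -!dotDl msum dot0l.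
    by apply/memS; split; rewrite !dotE; lra.
  apply/rowP => i; rewrite !mxE; lra.
have vertex_le w : S w -> [/\ dot m1 w <= s * k1, dot m2 w <= s * k2 &
    dot m3 w <= s * k3].
  move=> /centered[q /memS[q1 q2 q3] <-]; rewrite !dotE.
  by split; nra.
have [e1 _ _] : [/\ dot m1 w1 <= s * k1, dot m2 w1 <= s * k2 &
  dot m3 w1 <= s * k3] by apply: vertex_le; apply/memS; split; lra.
have [_ e2 _] : [/\ dot m1 w2 <= s * k1, dot m2 w2 <= s * k2 &
  dot m3 w2 <= s * k3] by apply: vertex_le; apply/memS; split; lra.
have [_ _ e3] : [/\ dot m1 w3 <= s * k1, dot m2 w3 <= s * k2 &
  dot m3 w3 <= s * k3] by apply: vertex_le; apply/memS; split; lra.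
have s2 : s = 2.
  apply/eqP; rewrite eq_le s_le2 /=.
  have : s * (k1 + k2 + k3) = s by rewrite ksum mulr1.
  by rewrite !mulrDr; lra.
rewrite s2 in e1 e2 e3.
have [k1E k2E k3E] : [/\ k1 = 1 / 3, k2 = 1 / 3 & k3 = 1 / 3].
  by split; lra.
subst k1 k2 k3.
have wsum : w1 + w2 + w3 = 0.
  have := ex 0; rewrite !dot0r !add0r -!scalerDr => /eqP.
  have /negPf third_neq0 : (1 / 3 : R) != 0 by apply: lt0r_neq0; lra.
  by rewrite eq_sym scaler_eq0 third_neq0 => /eqP.
apply: inhabits.
apply: (@CenteredFrame R S w1 w2 w3 m1 m2 m3) => //.
- move=> x; rewrite {1}(ex x) !scalerDl.
  rewrite -[RHS]addr0 -[in RHS](scaler0 _ (1 / 3)) -wsum !scalerDr.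
  by apply/rowP => i; rewrite !mxE; ring.
- by split; lra.
- by split; lra.
- by split; lra.
- move=> x; split=> [/memS[x1 x2 x3]|[x1 x2 x3]]; last apply/memS; split; lra.
Qed.

End CenteredFrame.

(** * Circumradius, diameter and inradius in coordinates *)

Section Support.
Variable R : realType.
Implicit Types (K : set 'rV[R]_2) (u x : 'rV[R]_2).

Lemma support_attained K u : K !=set0 -> compact K ->
  exists2 x, K x & support_function K u = dot u x /\
    forall y, K y -> dot u y <= dot u x.
Proof.
move=> K0 cK.
have [x /set_mem Kx xmax] := compact_EVT_max K0 cK
  (continuous_subspaceT (@dot_continuous R u)).
have xub y : K y -> dot u y <= dot u x by move=> Ky; exact/xmax/mem_set.
exists x => //; split=> //; apply/eqP; rewrite eq_le; apply/andP; split.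
  apply: ge_sup; first by exists (dot u x), x.
  by move=> _ [y Ky <-]; exact: xub.
apply: ub_le_sup; last by exists x.
by exists (dot u x) => _ [y Ky <-]; exact: xub.
Qed.

Lemma support_ge K u x : compact K -> K x -> dot u x <= support_function K u.
Proof.
move=> cK Kx.
have [y _ [-> ymax]] := @support_attained K u (ex_intro _ x Kx) cK.
exact: ymax.
Qed.

(** Three numbers k_i of sum zero split into one of one sign and two of the
    other; eliminating the isolated one writes the sum as a combination of two
    differences of the l_i with weights that add up to at most M. *)
Lemma zero_sum_pairing_le (d M l1 l2 l3 k1 k2 k3 : R) :
  l1 + l2 + l3 = 0 -> k1 + k2 + k3 = 0 ->
  - d <= l1 - l2 <= d -> - d <= l2 - l3 <= d -> - d <= l3 - l1 <= d ->
  - M <= k1 <= M -> - M <= k2 <= M -> - M <= k3 <= M ->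
  l1 * k1 + l2 * k2 + l3 * k3 <= d * M.
Proof.
move=> ls ks /andP[a1 a2] /andP[b1 b2] /andP[c1 c2] /andP[d1 d2]
  /andP[e1 e2] /andP[f1 f2].
have weighted (p q s t : R) : 0 <= p -> 0 <= q -> p + q <= M ->
    s <= d -> t <= d -> p * s + q * t <= d * M.
  by move=> p0 q0 pqM sd td; nra.
have l3E : l3 = - l1 - l2 by lra.
have k3E : k3 = - k1 - k2 by lra.
set v := l1 * k1 + l2 * k2 + l3 * k3.
have n1 : v = k2 * (l2 - l1) + k3 * (l3 - l1) by rewrite /v l3E k3E; ring.
have n2 : v = k1 * (l1 - l2) + k3 * (l3 - l2) by rewrite /v l3E k3E; ring.
have n3 : v = k1 * (l1 - l3) + k2 * (l2 - l3) by rewrite /v l3E k3E; ring.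
have m1 : v = - k2 * (l1 - l2) + - k3 * (l1 - l3) by rewrite n1; ring.
have m2 : v = - k1 * (l2 - l1) + - k3 * (l2 - l3) by rewrite n2; ring.
have m3 : v = - k1 * (l3 - l1) + - k2 * (l3 - l2) by rewrite n3; ring.
have [p1|p1] := leP 0 k1; have [p2|p2] := leP 0 k2; have [p3|p3] := leP 0 k3.
- by rewrite n1; apply: weighted; lra.
- by rewrite n3; apply: weighted; lra.
- by rewrite n2; apply: weighted; lra.
- by rewrite m1; apply: weighted; lra.
- by rewrite n1; apply: weighted; lra.
- by rewrite m2; apply: weighted; lra.
- by rewrite m3; apply: weighted; lra.
- by exfalso; lra.
Qed.

End Support.

Section Frame.
Variables (R : realType) (S : set 'rV[R]_2) (F : centered_frame S).
Implicit Types (K : set 'rV[R]_2) (t u x y : 'rV[R]_2).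
Local Notation v1 := (vertex1 F).
Local Notation v2 := (vertex2 F).
Local Notation v3 := (vertex3 F).
Local Notation n1 := (normal1 F).
Local Notation n2 := (normal2 F).
Local Notation n3 := (normal3 F).

Lemma normals_dot_sum x : dot n1 x + dot n2 x + dot n3 x = 0.
Proof. by rewrite -!dotDl normals_sum dot0l. Qed.

Lemma coordinates_inj x y :
  dot n1 x = dot n1 y -> dot n2 x = dot n2 y -> x = y.
Proof.
move=> e1 e2; rewrite [x](expansion F) [y](expansion F) e1 e2.
have xs := normals_dot_sum x; have ys := normals_dot_sum y.
by congr (_ + _ *: _); lra.
Qed.

Definition vertex_comb (p q r : R) : 'rV[R]_2 := p *: v1 + q *: v2 + r *: v3.

Lemma vertex_comb_dot p q r :
  [/\ dot n1 (vertex_comb p q r) = p - (p + q + r) / 3,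
      dot n2 (vertex_comb p q r) = q - (p + q + r) / 3 &
      dot n3 (vertex_comb p q r) = r - (p + q + r) / 3].
Proof.
rewrite /vertex_comb !dotE.
have [-> -> ->] := dual1 F; have [-> -> ->] := dual2 F.
by have [-> -> ->] := dual3 F; split; field.
Qed.

Lemma homothetP t (rho : R) x : 0 <= rho ->
  homothet t rho S x <->
  [/\ - (rho / 3) <= dot n1 x - dot n1 t, - (rho / 3) <= dot n2 x - dot n2 t &
      - (rho / 3) <= dot n3 x - dot n3 t].
Proof.
move=> rho0; split.
  by move=> [y /(mem_frame F)[y1 y2 y3] <-]; rewrite !dotE; split; nra.
have xs := normals_dot_sum x; have ts := normals_dot_sum t.
have [->|rhoN0] := eqVneq rho 0.
  move=> [x1 x2 x3]; exists 0.
    by apply/(mem_frame F); rewrite !dotE; split; lra.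
  by rewrite scale0r addr0; apply: coordinates_inj; lra.
have {rho0 rhoN0} rho0 : 0 < rho by rewrite lt_neqAle eq_sym rhoN0.
move=> [x1 x2 x3]; exists (rho^-1 *: (x - t)).
  apply/(mem_frame F); rewrite !dotE; split;
    by rewrite [rho^-1 * _]mulrC ler_pdivlMr//; lra.
by rewrite scalerA divff ?gt_eqF// scale1r addrC subrK.
Qed.

Lemma vertices_mem : [/\ S v1, S v2 & S v3].
Proof.
have [a1 a2 a3] := dual1 F; have [b1 b2 b3] := dual2 F.
have [c1 c2 c3] := dual3 F.
by split; apply/(mem_frame F); split; lra.
Qed.

Lemma frame_closed : closed S.
Proof.
have -> : S = (dot n1 @^-1` [set r | - (1 / 3) <= r]) `&`
    (dot n2 @^-1` [set r | - (1 / 3) <= r]) `&`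
    (dot n3 @^-1` [set r | - (1 / 3) <= r]).
  by apply/seteqP; split=> x => [/(mem_frame F)[]|[[? ?] ?]];
    [|apply/(mem_frame F)].
by do ?apply: closedI; apply: closed_comp => [? _|];
  do ?[exact: dot_continuous|exact: closed_ge].
Qed.

Lemma frame_compact : compact S.
Proof.
apply: bounded_closed_compact frame_closed.
exists (`|v1| + `|v2| + `|v3|); split; first exact: num_real.
move=> M ltM x /(mem_frame F)[x1 x2 x3]; apply: le_trans (ltW ltM).
have xs := normals_dot_sum x.
rewrite [x in `|x|](expansion F).
have le1 (r : R) (v : 'rV[R]_2) : - (1 / 3) <= r <= 1 -> `|r *: v| <= `|v|.
  move=> /andP[r0 r1]; rewrite normrZ ler_piMl// ler_norml; apply/andP.
  by split; lra.
apply: (le_trans (ler_normD _ _)); apply: lerD; last by apply: le1; lra.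
by apply: (le_trans (ler_normD _ _)); apply: lerD; apply: le1; lra.
Qed.

End Frame.

Section Functionals.
Variables (R : realType) (S : set 'rV[R]_2) (F : centered_frame S).
Implicit Types (K : set 'rV[R]_2) (t u x y : 'rV[R]_2).
Local Notation v1 := (vertex1 F).
Local Notation v2 := (vertex2 F).
Local Notation v3 := (vertex3 F).
Local Notation n1 := (normal1 F).
Local Notation n2 := (normal2 F).
Local Notation n3 := (normal3 F).

(** The triangle with inner normals [n_i] at levels [m_i] is the smallest
    homothetic copy of [S] around [K]: each of its sides touches [K]. *)
Definition circumscribed K (m1 m2 m3 : R) : Prop :=
  (forall x, K x -> [/\ m1 <= dot n1 x, m2 <= dot n2 x & m3 <= dot n3 x]) /\
  exists x1 x2 x3, [/\ K x1, K x2 & K x3] /\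
    [/\ dot n1 x1 = m1, dot n2 x2 = m2 & dot n3 x3 = m3].

Lemma circumscribed_exists K : K !=set0 -> compact K ->
  exists m1 m2 m3, circumscribed K m1 m2 m3.
Proof.
move=> K0 cK; have min n : exists2 x, K x & forall y, K y -> dot n x <= dot n y.
  have [x Kx [_ xmax]] := support_attained (- n) K0 cK.
  by exists x => // y /xmax; rewrite !dotNl lerN2.
have [x1 K1 min1] := min n1; have [x2 K2 min2] := min n2.
have [x3 K3 min3] := min n3.
exists (dot n1 x1), (dot n2 x2), (dot n3 x3); split; last by exists x1, x2, x3.
by move=> x Kx; split; [exact: min1 | exact: min2 | exact: min3].
Qed.

(** The forms sum to zero, so that summing the three containment inequalities
    eliminates the translation. *)
Lemma circumradiusE K m1 m2 m3 : circumscribed K m1 m2 m3 ->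
  circumradius K S = - (m1 + m2 + m3).
Proof.
move=> [mK [x1 [x2 [x3 [[K1 K2 K3] [e1 e2 e3]]]]]].
set c := - (m1 + m2 + m3).
have c0 : 0 <= c.
  by have [a1 a2 a3] := mK _ K1; have := normals_dot_sum F x1; rewrite /c; lra.
apply/eqP; rewrite eq_le; apply/andP; split.
  apply: ge_inf; first by exists 0 => r [].
  split=> //; exists (vertex_comb F m1 m2 m3) => x /mK[a1 a2 a3].
  have [b1 b2 b3] := vertex_comb_dot F m1 m2 m3.
  by apply/(homothetP F _ _ c0); rewrite b1 b2 b3 /c; split; lra.
apply: lb_le_inf => [|r [r0 [t Kt]]].
  exists c; split=> //; exists (vertex_comb F m1 m2 m3) => x /mK[a1 a2 a3].
  have [b1 b2 b3] := vertex_comb_dot F m1 m2 m3.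
  by apply/(homothetP F _ _ c0); rewrite b1 b2 b3 /c; split; lra.
have [a1 _ _] := (homothetP F _ _ r0).1 (Kt _ K1).
have [_ a2 _] := (homothetP F _ _ r0).1 (Kt _ K2).
have [_ _ a3] := (homothetP F _ _ r0).1 (Kt _ K3).
by have := normals_dot_sum F t; rewrite /c; lra.
Qed.

(** The differences of normals are, up to sign, the edge normals of the
    hexagon conv(S, -S), scaled to have maximum 1 on it; this says that K - K
    is contained in d times that hexagon. *)
Definition spread_le K (d : R) : Prop := forall x y, K x -> K y ->
  [/\ (dot n1 x - dot n2 x) - (dot n1 y - dot n2 y) <= d,
      (dot n2 x - dot n3 x) - (dot n2 y - dot n3 y) <= d &
      (dot n3 x - dot n1 x) - (dot n3 y - dot n1 y) <= d].

Lemma circumscribed_spread K m1 m2 m3 : circumscribed K m1 m2 m3 ->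
  spread_le K (2 * circumradius K S).
Proof.
move=> cK; rewrite (circumradiusE cK) => x y /cK.1[a1 a2 a3] /cK.1[b1 b2 b3].
have := normals_dot_sum F x; have := normals_dot_sum F y.
by split; lra.
Qed.

Lemma body_spread K : convex_body K -> spread_le K (2 * circumradius K S).
Proof.
case=> K0 cK _; have [m1 [m2 [m3 cm]]] := circumscribed_exists K0 cK.
exact: circumscribed_spread cm.
Qed.

Local Notation gauge u :=
  (Num.max (support_function S u) (support_function S (- u))).

(** The gauge of u is its maximum on the hexagon with vertices +v_i, -v_i. *)
Lemma gauge_vertex u :
  [/\ - gauge u <= dot u v1 <= gauge u, - gauge u <= dot u v2 <= gauge u &
      - gauge u <= dot u v3 <= gauge u].
Proof.
have [V1 V2 V3] := vertices_mem F.
have vertexP v : S v -> - gauge u <= dot u v <= gauge u.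
  move=> Sv; have a := support_ge u (frame_compact F) Sv.
  have b := support_ge (- u) (frame_compact F) Sv; rewrite dotNl in b.
  by rewrite lerNl !le_max a b orbT.
by split; exact: vertexP.
Qed.

Lemma dot_vertices u x : dot u x =
  dot n1 x * dot u v1 + dot n2 x * dot u v2 + dot n3 x * dot u v3.
Proof. by rewrite {1}(expansion F x) !dotE. Qed.

Lemma gauge_gt0 u : u != 0 -> 0 < gauge u.
Proof.
move=> u0; rewrite ltNge; apply/negP => g0.
have [a1 a2 a3] := gauge_vertex u.
case/eqP: u0; apply: dot_eq0 => x; rewrite dot_vertices.
have z r : - gauge u <= r <= gauge u -> r = 0 by move=> /andP[? ?]; lra.
by rewrite (z _ a1) (z _ a2) (z _ a3) !mulr0 !addr0.
Qed.

(** Only finitely many directions matter: for z = x - y both the coordinates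
    of z and the values of u at the vertices sum to zero, and the pairing of
    two such triples is controlled by differences on one side and absolute
    values on the other. *)
Lemma width_le K d u : K !=set0 -> compact K -> spread_le K d ->
  support_function K u + support_function K (- u) <= d * gauge u.
Proof.
move=> K0 cK dK.
have [x Kx [-> _]] := support_attained u K0 cK.
have [y Ky [-> _]] := support_attained (- u) K0 cK.
have [a1 a2 a3] := dK _ _ Kx Ky; have [b1 b2 b3] := dK _ _ Ky Kx.
have [g1 g2 g3] := gauge_vertex u.
have -> : dot u x + dot (- u) y = dot u (x - y) by rewrite !dotE.
have s0 : dot u v1 + dot u v2 + dot u v3 = 0.
  by rewrite -!dotDr vertices_sum dot0r.
rewrite dot_vertices; apply: zero_sum_pairing_le => //.
  exact: normals_dot_sum.
all: by rewrite !dotE; apply/andP; split; lra.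
Qed.

Let ratio K u := (support_function K u + support_function K (- u)) / gauge u.

Lemma ratio_le K d u : K !=set0 -> compact K -> spread_le K d -> u != 0 ->
  ratio K u <= d.
Proof.
move=> K0 cK dK u0; rewrite /ratio ler_pdivrMr ?gauge_gt0//.
exact: width_le.
Qed.

Lemma diameter_le K d : convex_body K -> spread_le K d ->
  diameter_max K S <= d.
Proof.
move=> [K0 cK _] dK; apply: ge_sup => [|_ [u u0 <-]]; last exact: ratio_le.
have n10 : n1 != 0.
  apply/eqP => n0; have [+ _ _] := dual1 F; rewrite n0 dot0l => e.
  by have : (0 : R) < 2 / 3; [lra | rewrite -e ltxx].
by exists (ratio K n1), n1.
Qed.

Lemma ratio_le_diameter K u : convex_body K -> u != 0 ->
  ratio K u <= diameter_max K S.
Proof.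
move=> bK u0; have [K0 cK _] := bK; apply: ub_le_sup; last by exists u.
exists (2 * circumradius K S) => _ [w w0 <-].
by apply: ratio_le => //; exact: body_spread.
Qed.

(** A direction u whose gauge is at most 1 shows that the diameter is at least
    the width of K in that direction. *)
Lemma dot_le_diameter K u x y : convex_body K -> u != 0 ->
  (forall z, S z -> - 1 <= dot u z <= 1) ->
  K x -> K y -> dot u x - dot u y <= diameter_max K S.
Proof.
move=> bK u0 u1 Kx Ky; have [K0 cK _] := bK.
wlog w0 : x y Kx Ky / 0 <= dot u x - dot u y.
  move=> wl; have [/wl|neg] := leP 0 (dot u x - dot u y); first exact.
  by have := wl _ _ Kx Kx; rewrite subrr lexx => /(_ isT); lra.
apply: le_trans (ratio_le_diameter bK u0).
rewrite /ratio ler_pdivlMr ?gauge_gt0//.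
have gle : gauge u <= 1.
  have S0 : S !=set0 by have [V _ _] := vertices_mem F; exists v1.
  have [p Sp [-> _]] := support_attained u S0 (frame_compact F).
  have [q Sq [-> _]] := support_attained (- u) S0 (frame_compact F).
  rewrite ge_max dotNl lerNl.
  by have /andP[_ ->] := u1 _ Sp; have /andP[-> _] := u1 _ Sq.
have a := support_ge u cK Kx; have b := support_ge (- u) cK Ky.
by rewrite dotNl in b; nra.
Qed.

Lemma diameter_spread K : convex_body K -> spread_le K (diameter_max K S).
Proof.
move=> bK x y Kx Ky.
have [a1 a2 a3] := dual1 F; have [b1 b2 b3] := dual2 F.
have [c1 c2 c3] := dual3 F.
have neq0 (u : 'rV[R]_2) v : dot u v = 1 -> u != 0.
  by move=> e; apply/eqP => u0; move: e; rewrite u0 dot0l; lra.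
have le1 z : S z -> [/\ - 1 <= dot (n1 - n2) z <= 1,
    - 1 <= dot (n2 - n3) z <= 1 & - 1 <= dot (n3 - n1) z <= 1].
  move=> /(mem_frame F)[z1 z2 z3]; have := normals_dot_sum F z.
  by rewrite !dotE; split; apply/andP; split; lra.
split.
- have := @dot_le_diameter K (n1 - n2) x y bK; rewrite !dotE; apply=> //.
    by apply: (@neq0 _ v1); rewrite !dotE; lra.
  by move=> z /le1[].
- have := @dot_le_diameter K (n2 - n3) x y bK; rewrite !dotE; apply=> //.
    by apply: (@neq0 _ v2); rewrite !dotE; lra.
  by move=> z /le1[].
- have := @dot_le_diameter K (n3 - n1) x y bK; rewrite !dotE; apply=> //.
    by apply: (@neq0 _ v3); rewrite !dotE; lra.
  by move=> z /le1[].
Qed.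

(** On [S] the difference [n1 - n2] oscillates by exactly 2. *)
Lemma homothet_spread K d t (rho : R) : spread_le K d ->
  homothet t rho S `<=` K -> 2 * rho <= d.
Proof.
move=> dK tK; have [V1 V2 _] := vertices_mem F.
have [] := dK (t + rho *: v1) (t + rho *: v2); [by apply: tK; exists v1|
  by apply: tK; exists v2|].
have [a1 a2 _] := dual1 F; have [b1 b2 _] := dual2 F.
by rewrite !dotE a1 a2 b1 b2 => + _ _; lra.
Qed.

Lemma inradius_ge K d t (rho : R) : spread_le K d -> 0 <= rho ->
  homothet t rho S `<=` K -> rho <= inradius K S.
Proof.
move=> dK rho0 tK; apply: ub_le_sup; last by split=> //; exists t.
by exists (d / 2) => r [r0 [s sK]]; have := homothet_spread dK sK; lra.
Qed.

Lemma point_homothet K x : K x -> homothet x 0 S `<=` K.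
Proof. by move=> Kx _ [y _ <-]; rewrite scale0r addr0. Qed.

Lemma inradius_le K (c : R) : K !=set0 ->
  (forall t rho, 0 <= rho -> homothet t rho S `<=` K -> rho <= c) ->
  inradius K S <= c.
Proof.
move=> [x Kx] cK; apply: ge_sup => [|r [r0 [t tK]]]; last exact: cK tK.
by exists 0; split=> //; exists x; exact: point_homothet.
Qed.

(** The k-th vertex of the inscribed copy lies on the side of the triangle
    x1 x2 x3 opposite to x_k: the vertices are a x2 + (1-a) x3,
    (1-b) x1 + b x3 and c x1 + (1-c) x2. Their differences are multiples of the
    edges of [S] with the common factor rho f. *)
Lemma inscribed_homothet K x1 x2 x3 t (rho a b c : R) : convex_set K ->
  K x1 -> K x2 -> K x3 -> 0 <= a <= 1 -> 0 <= b <= 1 -> 0 <= c <= 1 ->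
  x1 = t + rho *: vertex_comb F 0 (1 - a) a ->
  x2 = t + rho *: vertex_comb F b 0 (1 - b) ->
  x3 = t + rho *: vertex_comb F (1 - c) c 0 ->
  homothet (t + rho *: vertex_comb F (b * (1 - c)) (c * (1 - a)) (a * (1 - b)))
    (rho * (1 - (a + b + c) + (a * b + b * c + c * a))) S `<=` K.
Proof.
move=> cK K1 K2 K3 /andP[a0 a1] /andP[b0 b1] /andP[c0 c1] e1 e2 e3.
move=> _ [s /(mem_frame F)[s1 s2 s3] <-].
have ss := normals_dot_sum F s.
pose p1 := dot n1 s + 1 / 3; pose p2 := dot n2 s + 1 / 3.
pose p3 := dot n3 s + 1 / 3.
have [q1 q2 q3] : [/\ 0 <= p1, 0 <= p2 & 0 <= p3].
  by rewrite /p1 /p2 /p3; split; lra.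
have p3E : p3 = 1 - p1 - p2 by rewrite /p1 /p2 /p3; lra.
have sE : s = vertex_comb F p1 p2 p3.
  have [c1E c2E c3E] := vertex_comb_dot F p1 p2 p3.
  by apply: (@coordinates_inj _ _ F); rewrite ?c1E ?c2E p3E /p1 /p2; lra.
rewrite [X in K X](_ : _ = (p2 * (1 - b) + p3 * c) *: x1
    + (p1 * a + p3 * (1 - c)) *: x2
    + (p1 * (1 - a) + p2 * b) *: x3); last first.
  rewrite sE e1 e2 e3 /vertex_comb p3E; apply/rowP => i; rewrite !mxE; ring.
apply: convex_set_comb3 => //; last by rewrite p3E; ring.
all: by apply: addr_ge0; apply: mulr_ge0 => //; lra.
Qed.

End Functionals.

(** * The inequalities *)

Section Inequalities.
Variables (R : realType) (S : set 'rV[R]_2) (F : centered_frame S).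
Implicit Types K : set 'rV[R]_2.

Lemma circumradius_gt0 K : nontrivial_convex_body K -> 0 < circumradius K S.
Proof.
move=> [[K0 cK _] Knp].
have [m1 [m2 [m3 cm]]] := circumscribed_exists F K0 cK.
rewrite (circumradiusE cm) ltNge; apply/negP => le0.
have [x Kx] := K0; apply: (Knp x); apply/seteqP; split=> [y Ky|_ ->//].
have [a1 a2 a3] := cm.1 _ Kx; have [b1 b2 b3] := cm.1 _ Ky.
have := normals_dot_sum F x; have := normals_dot_sum F y => ys xs.
by apply: (@coordinates_inj _ _ F); lra.
Qed.

(** With e = d - 1 the cyclic differences x, y, z are at most e and sum to zero,
    and the sum of (e-x)(e-y), (e-y)(e-z), (e-z)(e-x) is
    3e^2 - (x^2+y^2+z^2)/2. This bounds the sum of squares that is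
    subtracted in
    f = 1/4 + (a+b+c-3/2)^2/3 - (x^2+y^2+z^2)/6. *)
Lemma inradius_triangle_bound (a b c d : R) :
  b - a <= d - 1 -> c - b <= d - 1 -> a - c <= d - 1 ->
  (d - 1 / 2) * (3 / 2 - d) <= 1 - (a + b + c) + (a * b + b * c + c * a).
Proof.
move=> ab bc ca.
have h1 : 0 <= (d - 1 - (b - a)) * (d - 1 - (c - b)).
  by apply: mulr_ge0; lra.
have h2 : 0 <= (d - 1 - (c - b)) * (d - 1 - (a - c)).
  by apply: mulr_ge0; lra.
have h3 : 0 <= (d - 1 - (a - c)) * (d - 1 - (b - a)).
  by apply: mulr_ge0; lra.
have h4 : 0 <= (a + b + c - 3 / 2) ^+ 2 by exact: sqr_ge0.
by nra.
Qed.

(** In the fourth and fifth inequalities the diameter enters only through the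
    three pairs of touching points, which give D >= r (1 + b - a) and its
    cyclic variants, for r the circumradius; their sum is 3 D >= 3 r. *)
Lemma body_inequalities K : nontrivial_convex_body K ->
  [/\ diameter_max K S / 2 <= circumradius K S,
      inradius K S <= diameter_max K S / 2,
      0 <= inradius K S,
      circumradius K S <= diameter_max K S &
      (diameter_max K S / circumradius K S - 1 / 2) *
      (3 / 2 - diameter_max K S / circumradius K S)
        <= inradius K S / circumradius K S].
Proof.
move=> ntK; have [bK _] := ntK; have [K0 cK vK] := bK.
have R0 := circumradius_gt0 ntK; have dK := diameter_spread F bK.
have [x Kx] := K0.
have [m1 [m2 [m3 cm]]] := circumscribed_exists F K0 cK.
have RE := circumradiusE cm.
have [mK [x1 [x2 [x3 [[K1 K2 K3] [e1 e2 e3]]]]]] := cm.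
set r := circumradius K S in R0 RE *; set D := diameter_max K S in dK *.
have [a1 a2 a3] := mK _ K1; have [b1 b2 b3] := mK _ K2.
have [c1 c2 c3] := mK _ K3.
have s1 := normals_dot_sum F x1; have s2 := normals_dot_sum F x2.
have s3 := normals_dot_sum F x3.
(* The touching points relative to the circumscribed triangle, of size r. *)
pose a := (dot (normal3 F) x1 - m3) / r.
pose b := (dot (normal1 F) x2 - m1) / r.
pose c := (dot (normal2 F) x3 - m2) / r.
have rN0 : r != 0 by rewrite gt_eqF.
have aE : dot (normal3 F) x1 = m3 + r * a by rewrite /a mulrC divfK// subrKC.
have bE : dot (normal1 F) x2 = m1 + r * b by rewrite /b mulrC divfK// subrKC.
have cE : dot (normal2 F) x3 = m2 + r * c by rewrite /c mulrC divfK// subrKC.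
have a01 : 0 <= a <= 1.
  by rewrite /a ler_pdivlMr// ler_pdivrMr// mul0r mul1r; apply/andP; split; lra.
have b01 : 0 <= b <= 1.
  by rewrite /b ler_pdivlMr// ler_pdivrMr// mul0r mul1r; apply/andP; split; lra.
have c01 : 0 <= c <= 1.
  by rewrite /c ler_pdivlMr// ler_pdivrMr// mul0r mul1r; apply/andP; split; lra.
clearbody a b c.
have [Dab _ _] := dK _ _ K2 K1; have [_ Dbc _] := dK _ _ K3 K2.
have [_ _ Dca] := dK _ _ K1 K3.
split.
- by have := diameter_le bK (body_spread F bK); rewrite -/D -/r; lra.
- apply: (inradius_le K0) => t rho _ tK.
  by have := homothet_spread dK tK; lra.
- exact: (inradius_ge dK (lexx 0) (point_homothet Kx)).
- by lra.
pose f := 1 - (a + b + c) + (a * b + b * c + c * a).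
have rf : r * f <= inradius K S.
  pose y p q s := vertex_comb F m1 m2 m3 + r *: vertex_comb F p q s.
  have coordsE p q s :
      [/\ dot (normal1 F) (y p q s) = m1 + r / 3 + r * (p - (p + q + s) / 3),
          dot (normal2 F) (y p q s) = m2 + r / 3 + r * (q - (p + q + s) / 3) &
          dot (normal3 F) (y p q s) = m3 + r / 3 + r * (s - (p + q + s) / 3)].
    have [l1 l2 l3] := vertex_comb_dot F m1 m2 m3.
    have [k1 k2 k3] := vertex_comb_dot F p q s.
    rewrite /y !(dotDr _ (vertex_comb F m1 m2 m3)) !(dotZr _ r).
    by rewrite l1 l2 l3 k1 k2 k3 RE; split; field.
  have f0 : 0 <= f.
    move: a01 b01 c01 => /andP[? ?] /andP[? ?] /andP[? ?].
    have -> : f = a * b * c + (1 - a) * (1 - b) * (1 - c) by rewrite /f; ring.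
    by apply: addr_ge0; do ?apply: mulr_ge0; rewrite ?subr_ge0.
  apply: (inradius_ge dK (mulr_ge0 (ltW R0) f0)).
  apply: (@inscribed_homothet _ _ F K x1 x2 x3 (vertex_comb F m1 m2 m3)) => //.
  - have [k1 k2 k3] := coordsE 0 (1 - a) a.
    by apply: (@coordinates_inj _ _ F); rewrite ?k1 ?k2; lra.
  - have [k1 k2 k3] := coordsE b 0 (1 - b).
    by apply: (@coordinates_inj _ _ F); rewrite ?k1 ?k2; lra.
  - have [k1 k2 k3] := coordsE (1 - c) c 0.
    by apply: (@coordinates_inj _ _ F); rewrite ?k1 ?k2; lra.
apply: (@le_trans _ _ f); last by rewrite ler_pdivlMr// mulrC.
apply: inradius_triangle_bound; rewrite lerBrDr ler_pdivlMr//; lra.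
Qed.

End Inequalities.

(** * Intermediate values of star-shaped functions *)

Section IntermediateValue.
Variable R : realType.

(** The first hypothesis says that g(l)/l is nonincreasing, which excludes
    upward jumps of g; so the supremum L of the points where g is at most x
    has value exactly x, provided that L > 0. This holds because the linear
    upper bound keeps g below x near 0. *)
Lemma star_intermediate_value (g : R -> R) (r0 C x : R) :
  (forall s m, 0 <= s <= 1 -> 0 <= m <= 1 -> s * g m <= g (s * m)) ->
  (forall l, 0 <= l <= 1 -> g l <= r0 + C * l) ->
  0 <= r0 -> r0 <= g 0 -> 0 < C -> r0 <= x -> x <= g 1 ->
  exists2 l, 0 <= l <= 1 & g l = x.
Proof.
move=> star upper r00 rg C0 rx xg.
have [xr|xr] := eqVneq x r0.
  exists 0; first by rewrite lexx ler01.
  apply/eqP; rewrite eq_le xr rg andbT.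
  by have := upper 0; rewrite lexx ler01 mulr0 addr0; exact.
have {rx xr}rx : r0 < x by rewrite lt_neqAle eq_sym xr.
pose A := [set l | 0 <= l <= 1 /\ g l <= x].
have ubA : has_ubound A by exists 1 => l [/andP[]].
pose l0 := Num.min 1 ((x - r0) / C).
have l0_gt0 : 0 < l0 by rewrite lt_min ltr01 divr_gt0 ?subr_gt0.
have Al0 : A l0.
  have l01 : 0 <= l0 <= 1 by rewrite (ltW l0_gt0) /l0 ge_min lexx.
  split=> //; apply: (le_trans (upper _ l01)).
  have : l0 <= (x - r0) / C by rewrite /l0 ge_min lexx orbT.
  by rewrite ler_pdivlMr//; lra.
pose L := sup A.
have L_gt0 : 0 < L by apply: (lt_le_trans l0_gt0); exact: ub_le_sup.
have L_le1 : L <= 1 by apply: ge_sup; [exists l0 | move=> l [/andP[]]].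
have L01 : 0 <= L <= 1 by rewrite ltW.
exists L => //; apply/eqP; rewrite eq_le; apply/andP; split.
  rewrite leNgt; apply/negP => xL.
  have g_gt0 : 0 < g L by lra.
  suff : L <= L * x / g L.
    by rewrite ler_pdivlMr// ler_pM2l//; lra.
  apply: ge_sup => [|l Al]; first by exists l0.
  have lL : l <= L by exact: ub_le_sup.
  have [/andP[l_ge0 l1] glx] := Al.
  have lL01 : 0 <= l / L <= 1.
    by rewrite divr_ge0 ?(ltW L_gt0)//= ler_pdivrMr// mul1r.
  have := star _ _ lL01 L01; rewrite divfK ?gt_eqF// => h.
  rewrite ler_pdivlMr// (mulrC L) -ler_pdivrMr// mulrAC.
  exact: le_trans h glx.
rewrite leNgt; apply/negP => gx.
have L_lt1 : L < 1.
  rewrite lt_neqAle L_le1 andbT; apply/eqP => L1.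
  by move: gx xg; rewrite L1; lra.
have above m : L < m -> m <= 1 -> L * x < m * g L.
  move=> Lm m1; have m0 : 0 < m by lra.
  have xm : x < g m.
    rewrite ltNge; apply/negP => gm; suff : m <= L by lra.
    by apply: ub_le_sup => //; split=> //; apply/andP; split; lra.
  have Lm01 : 0 <= L / m <= 1.
    by rewrite divr_ge0 ?(ltW L_gt0) ?(ltW m0)//= ler_pdivrMr// mul1r ltW.
  have m01 : 0 <= m <= 1 by rewrite (ltW m0).
  have := star _ _ Lm01 m01; rewrite divfK ?gt_eqF//.
  rewrite mulrAC ler_pdivrMr// [g L * m]mulrC; apply: lt_le_trans.
  by rewrite ltr_pM2l.
have gL_gt0 : 0 < g L.
  have := above 1 L_lt1 (lexx 1); rewrite mul1r; apply: lt_trans.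
  by apply: mulr_gt0 => //; lra.
pose m := Num.min 1 (L * x / g L).
have : L * x < m * g L.
  apply: above; rewrite /m; last by rewrite ge_min lexx.
  by rewrite lt_min L_lt1 ltr_pdivlMr// ltr_pM2l.
rewrite ltNge => /negP; apply.
by rewrite -ler_pdivlMr// /m ge_min lexx orbT.
Qed.

End IntermediateValue.

(** * Polygons realizing the diagram *)

Section MovingPolygon.
Variable R : realType.
Implicit Types (cs : seq ('rV[R]_2 * R * R)) (x y : 'rV[R]_2) (l m s : R).

(** A constraint (u, k, k') stands for the half-plane of all x with
    u.x + k + l k' >= 0, which moves linearly with the time l. *)
Definition moving_polygon cs l : set 'rV[R]_2 := [set x |
  foldr (fun c P => 0 <= dot c.1.1 x + c.1.2 + l * c.2 /\ P) True cs].

(** Each constraint is jointly affine in time and position. *)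
Lemma moving_polygon_mix cs l m s x y : 0 <= s <= 1 ->
  moving_polygon cs l x -> moving_polygon cs m y ->
  moving_polygon cs ((1 - s) * l + s * m) ((1 - s) *: x + s *: y).
Proof.
move=> /andP[s0 s1]; rewrite /moving_polygon /=.
elim: cs => //= -[[u k] k'] cs IH /= [x0 xs] [y0 ys]; split; last exact: IH.
rewrite !dotE [X in 0 <= X](_ : _ = (1 - s) * (dot u x + k + l * k')
  + s * (dot u y + k + m * k')); last by ring.
by apply: addr_ge0; apply: mulr_ge0 => //; lra.
Qed.

Lemma moving_polygon_convex cs l : convex_set (moving_polygon cs l).
Proof.
apply/convex_setP => x y k /andP[k0 k1] lx ly.
have := @moving_polygon_mix cs l l (1 - k) x y.
rewrite subKr -mulrDl subrKC mul1r.
by apply=> //; apply/andP; split; lra.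
Qed.

Lemma moving_polygon_closed cs l : closed (moving_polygon cs l).
Proof.
rewrite /moving_polygon; elim: cs => [|[[u k] k'] cs IH] /=.
  by rewrite (_ : mkset _ = setT) ?closedT //; apply/seteqP.
apply: closedI IH.
rewrite [X in closed X](_ : _ = dot u @^-1` [set r | - (k + l * k') <= r]);
  last first.
  by apply/seteqP; split=> x /=; lra.
by apply: closed_comp => [? _|]; [exact: dot_continuous|exact: closed_ge].
Qed.

End MovingPolygon.

Section Realization.
Variables (R : realType) (S : set 'rV[R]_2) (F : centered_frame S).
Variables (a b c d : R).
Local Notation n1 := (normal1 F).
Local Notation n2 := (normal2 F).
Local Notation n3 := (normal3 F).
Local Notation p1 x := (dot n1 x + 1 / 3).
Local Notation p2 x := (dot n2 x + 1 / 3).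
Local Notation p3 x := (dot n3 x + 1 / 3).
Local Notation form u1 u2 u3 := (u1 *: n1 + u2 *: n2 + u3 *: n3).

Let h := (1 + d) / 2.
Let f := 1 - (a + b + c) + (a * b + b * c + c * a).

(** At time 0 the last three constraints, whose coefficients are the cofactors
    of the matrix of barycentric coordinates of the points (0, 1-a, a),
    (b, 0, 1-b), (1-c, c, 0), bound the triangle spanned by these points
    when it is nondegenerate; the constant terms turn forms in the p_i
    into forms in the [n_i]. At time 1 these constraints are void on [S] when
    a, b, c lie in [0, 1]. The six constraints before them confine p1 - p2,
    p2 - p3 and p3 - p1 to intervals of length 1 + d = 2 h. These move from
    positions adapted to that triangle, [a - 1, b], [b - 1, b + d] and
    [-h, h], to [-h, h] for all three differences, where b = a + d. The first
    three constraints are those of [S]. *)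
Definition path_constraints : seq ('rV[R]_2 * R * R) :=
  [:: (n1, 1 / 3, 0); (n2, 1 / 3, 0); (n3, 1 / 3, 0);
      (n1 - n2, 1 - a, a - 1 + h); (n2 - n1, b, h - b);
      (n2 - n3, 1 - b, b - 1 + h); (n3 - n2, b + d, h - (b + d));
      (n3 - n1, h, 0); (n1 - n3, h, 0);
      (form (- (c * (1 - b))) ((1 - c) * (1 - b)) (b * c),
        (- (c * (1 - b)) + (1 - c) * (1 - b) + b * c) / 3, 1);
      (form (c * a) (- (a * (1 - c))) ((1 - a) * (1 - c)),
        (c * a - a * (1 - c) + (1 - a) * (1 - c)) / 3, 1);
      (form ((1 - b) * (1 - a)) (a * b) (- (b * (1 - a))),
        ((1 - b) * (1 - a) + a * b - b * (1 - a)) / 3, 1)].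

Definition path_body (l : R) : set 'rV[R]_2 :=
  moving_polygon path_constraints l.

Lemma path_bodyP l x : path_body l x <->
  [/\ [/\ 0 <= p1 x, 0 <= p2 x & 0 <= p3 x],
      [/\ 0 <= p1 x - p2 x + 1 - a + l * (a - 1 + h),
          0 <= p2 x - p1 x + b + l * (h - b),
          0 <= p2 x - p3 x + 1 - b + l * (b - 1 + h) &
          0 <= p3 x - p2 x + b + d + l * (h - (b + d))],
      - h <= p3 x - p1 x <= h &
      [/\ 0 <= - (c * (1 - b)) * p1 x + (1 - c) * (1 - b) * p2 x + b * c * p3 x
             + l,
          0 <= c * a * p1 x - a * (1 - c) * p2 x + (1 - a) * (1 - c) * p3 x
             + l &
          0 <= (1 - b) * (1 - a) * p1 x + a * b * p2 x - b * (1 - a) * p3 x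
             + l]].
Proof.
rewrite /path_body /moving_polygon /=; rewrite !dotE; split.
  move=> [k1 [k2 [k3 [k4 [k5 [k6 [k7 [k8 [k9 [k10 [k11 [k12 _]]]]]]]]]]]].
  split; first by split; lra.
  - by split; lra.
  - by apply/andP; split; lra.
  - by split; lra.
move=> [[k1 k2 k3] [k4 k5 k6 k7] /andP[k8 k9] [k10 k11 k12]].
by do !split; lra.
Qed.

Lemma vertex_comb_barycentric p q r : p + q + r = 1 ->
  [/\ p1 (vertex_comb F p q r) = p, p2 (vertex_comb F p q r) = q &
      p3 (vertex_comb F p q r) = r].
Proof.
by move=> e; have [-> -> ->] := vertex_comb_dot F p q r; rewrite e; split; ring.
Qed.

(** The points (0, 1-a, a), (b, 0, 1-b), (1-c, c, 0) satisfy the constraints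
    at time 0, and the first two realize the diameter 1 + d. *)
Definition low_triangle : Prop :=
  [/\ [/\ 0 <= d <= 1, 0 <= a, b <= 1, 0 <= c <= 1 & b = a + d],
      a - 1 <= 1 - 2 * c <= b, b - 1 <= 1 - 2 * a <= b + d, c <= b + d &
      [/\ a <= h, 1 - h <= c & - h <= 1 - 2 * b <= h]].
Hypothesis low : low_triangle.

Lemma low_triangle_bounds : [/\ 0 <= a <= 1, 0 <= b <= 1 & 0 <= c <= 1].
Proof.
case: low => -[/andP[d0 d1] a0 b1 /andP[c0 c1] bE] _ _ _ _.
by split; apply/andP; split; lra.
Qed.

(** A cofactor row has one negative coefficient, which is at least -1. *)
Lemma cofactor_ge (p q r u v w : R) : 0 <= p -> 0 <= q -> 0 <= r ->
  p + q + r = 1 -> 0 <= u <= 1 -> 0 <= v -> 0 <= w ->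
  0 <= - u * p + v * q + w * r + 1.
Proof.
move=> p0 q0 r0 pqr /andP[u0 u1] v0 w0.
have := mulr_ge0 v0 q0; have := mulr_ge0 w0 r0.
have : u * p <= 1 * 1 by apply: ler_pM; lra.
by lra.
Qed.

Lemma path_body1 x : 0 <= p1 x -> 0 <= p2 x -> 0 <= p3 x ->
  - h <= p1 x - p2 x <= h -> - h <= p2 x - p3 x <= h ->
  - h <= p3 x - p1 x <= h -> path_body 1 x.
Proof.
move=> k1 k2 k3 /andP[l1 l2] /andP[l3 l4] l5.
have [/andP[a0 a1] /andP[b0 b1] /andP[c0 c1]] := low_triangle_bounds.
have s := normals_dot_sum F x.
have prod01 (u v : R) : 0 <= u <= 1 -> 0 <= v <= 1 -> 0 <= u * (1 - v) <= 1.
  move=> /andP[u0 u1] /andP[w0 w1]; apply/andP; split.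
    by apply: mulr_ge0; lra.
  by rewrite -[leRHS]mulr1; apply: ler_pM; lra.
have [A B C] := low_triangle_bounds.
have s1 : p1 x + p2 x + p3 x = 1 by lra.
have s2 : p2 x + p3 x + p1 x = 1 by lra.
have s3 : p3 x + p1 x + p2 x = 1 by lra.
apply/path_bodyP; split=> //; first by split; lra.
have [e1 e2 e3] : [/\ 0 <= 1 - a, 0 <= 1 - b & 0 <= 1 - c] by split; lra.
split.
- exact: (cofactor_ge k1 k2 k3 s1 (prod01 _ _ C B) (mulr_ge0 e3 e2)
    (mulr_ge0 b0 c0)).
- have := cofactor_ge k2 k3 k1 s2 (prod01 _ _ A C) (mulr_ge0 e1 e3)
    (mulr_ge0 c0 a0).
  by lra.
- have := cofactor_ge k3 k1 k2 s3 (prod01 _ _ B A) (mulr_ge0 e2 e1)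
    (mulr_ge0 a0 b0).
  by lra.
Qed.

Lemma low_triangle_f_ge0 : 0 <= f.
Proof.
have [/andP[a0 a1] /andP[b0 b1] /andP[c0 c1]] := low_triangle_bounds.
have -> : f = a * b * c + (1 - a) * (1 - b) * (1 - c) by rewrite /f; ring.
by apply: addr_ge0; do ?apply: mulr_ge0; lra.
Qed.

Lemma path_body0_vertices :
  [/\ path_body 0 (vertex_comb F 0 (1 - a) a),
      path_body 0 (vertex_comb F b 0 (1 - b)) &
      path_body 0 (vertex_comb F (1 - c) c 0)].
Proof.
have [/andP[a0 a1] /andP[b0 b1] /andP[c0 c1]] := low_triangle_bounds.
have f0 := low_triangle_f_ge0; rewrite /f in f0.
case: low => -[/andP[? ?] ? ? /andP[? ?] ?] /andP[? ?] /andP[? ?] ?.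
move=> [? ? /andP[? ?]].
split; apply/path_bodyP.
- have [-> -> ->] := @vertex_comb_barycentric 0 (1 - a) a ltac:(ring).
  by split; [split; lra|split; lra|apply/andP; split; lra|split; lra].
- have [-> -> ->] := @vertex_comb_barycentric b 0 (1 - b) ltac:(ring).
  by split; [split; lra|split; lra|apply/andP; split; lra|split; lra].
- have [-> -> ->] := @vertex_comb_barycentric (1 - c) c 0 ltac:(ring).
  by split; [split; lra|split; lra|apply/andP; split; lra|split; lra].
Qed.

Lemma path_body1_points :
  [/\ path_body 1 (vertex_comb F 0 h (1 - h)),
      path_body 1 (vertex_comb F h 0 (1 - h)) &
      path_body 1 (vertex_comb F (1 / 2) (1 / 2) 0)].
Proof.
have [[/andP[d0 d1] _ _ _ _] _ _ _ _] := low.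
split; apply: path_body1.
1-6: have [e1 e2 e3] := @vertex_comb_barycentric 0 h (1 - h) ltac:(ring).
7-12: have [e1 e2 e3] := @vertex_comb_barycentric h 0 (1 - h) ltac:(ring).
13-18: have [e1 e2 e3] :=
  @vertex_comb_barycentric (1 / 2) (1 / 2) 0 ltac:(lra).
all: by rewrite ?e1 ?e2 ?e3 /h; lra.
Qed.


Implicit Types (l m s rho : R).

Lemma path_body_mix l x y : 0 <= l <= 1 -> path_body 0 x -> path_body 1 y ->
  path_body l ((1 - l) *: x + l *: y).
Proof.
move=> l01 Kx Ky; have := moving_polygon_mix l01 Kx Ky.
by rewrite mulr0 add0r mulr1.
Qed.

Lemma path_body_scale s m x y : 0 <= s <= 1 -> path_body 0 x ->
  path_body m y -> path_body (s * m) ((1 - s) *: x + s *: y).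
Proof.
by move=> s01 Kx Ky; have := moving_polygon_mix s01 Kx Ky; rewrite mulr0 add0r.
Qed.

Lemma path_body_sub l : path_body l `<=` S.
Proof.
move=> x /path_bodyP[[k1 k2 k3] _ _ _]; apply/(mem_frame F).
by split; lra.
Qed.

(** The touching points at times 0 and 1 are mixed; the bounds for p1 - p2 are
    attained by the first two of them at both times, hence at every time. *)
Lemma path_body_points l : 0 <= l <= 1 -> exists z1 z2 z3,
  [/\ [/\ path_body l z1, path_body l z2 & path_body l z3],
      [/\ dot n1 z1 = - (1 / 3), dot n2 z2 = - (1 / 3) &
          dot n3 z3 = - (1 / 3)] &
      dot n1 z2 - dot n2 z2 - (dot n1 z1 - dot n2 z1) = 1 + d].
Proof.
move=> l01; have [X1 X2 X3] := path_body0_vertices.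
have [U1 U2 U3] := path_body1_points.
have M1 := path_body_mix l01 X1 U1; have M2 := path_body_mix l01 X2 U2.
have M3 := path_body_mix l01 X3 U3; move: M1 M2 M3.
set z1 := (X in path_body l X -> _); move=> M1.
set z2 := (X in path_body l X -> _); move=> M2.
set z3 := (X in path_body l X -> _); move=> M3.
exists z1, z2, z3.
have mixE u x y : dot u ((1 - l) *: x + l *: y) =
  (1 - l) * dot u x + l * dot u y by rewrite dotDr !dotZr.
have [[_ _ _ _ bE] _ _ _ _] := low.
split=> //; rewrite /z1 /z2 /z3 !mixE.
  have [-> _ _] := vertex_comb_dot F 0 (1 - a) a.
  have [_ -> _] := vertex_comb_dot F b 0 (1 - b).
  have [_ _ ->] := vertex_comb_dot F (1 - c) c 0.
  have [-> _ _] := vertex_comb_dot F 0 ((1 + d) / 2) (1 - (1 + d) / 2).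
  have [_ -> _] := vertex_comb_dot F ((1 + d) / 2) 0 (1 - (1 + d) / 2).
  have [_ _ ->] := vertex_comb_dot F (1 / 2) (1 / 2) 0.
  by split; field.
have [-> -> _] := vertex_comb_dot F 0 (1 - a) a.
have [-> -> _] := vertex_comb_dot F b 0 (1 - b).
have [-> -> _] := vertex_comb_dot F 0 ((1 + d) / 2) (1 - (1 + d) / 2).
have [-> -> _] := vertex_comb_dot F ((1 + d) / 2) 0 (1 - (1 + d) / 2).
by rewrite bE; field.
Qed.

Lemma path_body_nontrivial l : 0 <= l <= 1 ->
  nontrivial_convex_body (path_body l).
Proof.
move=> l01.
have [z1 [z2 [z3 [[K1 K2 K3] [e1 e2 e3] _]]]] := path_body_points l01.
split=> [|p Kp].
  split; [by exists z1| |exact: moving_polygon_convex].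
  apply: (subclosed_compact _ (frame_compact F)); last exact: path_body_sub.
  exact: moving_polygon_closed.
move: K1 K2 K3; rewrite Kp /= => z1p z2p z3p; subst z1 z2 z3.
suff : (0 : R) < 0 by rewrite ltxx.
by have := normals_dot_sum F p; lra.
Qed.

Lemma path_body_circumradius l : 0 <= l <= 1 ->
  circumradius (path_body l) S = 1.
Proof.
move=> l01; have [z1 [z2 [z3 [Kz [e1 e2 e3] _]]]] := path_body_points l01.
rewrite (@circumradiusE _ _ F _ (- (1 / 3)) (- (1 / 3)) (- (1 / 3)));
  last first.
  split; first by move=> x /path_body_sub/(mem_frame F).
  by exists z1, z2, z3.
by field.
Qed.

Lemma path_body_spread l : spread_le F (path_body l) (1 + d).
Proof.
move=> x y /path_bodyP[_ [x1 x2 x3 x4] /andP[x5 x6] _].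
move=> /path_bodyP[_ [y1 y2 y3 y4] /andP[y5 y6] _].
have [[_ _ _ _ bE] _ _ _ _] := low.
by rewrite /h ?bE in x1 x2 x3 x4 x5 x6 y1 y2 y3 y4 y5 y6; split; lra.
Qed.

Lemma path_body_diameter l : 0 <= l <= 1 ->
  diameter_max (path_body l) S = 1 + d.
Proof.
move=> l01; have [z1 [z2 [z3 [[K1 K2 K3] _ dE]]]] := path_body_points l01.
have [bK _] := path_body_nontrivial l01.
apply/eqP; rewrite eq_le (diameter_le bK (@path_body_spread l)) /= -dE.
by have [] := diameter_spread F bK K2 K1.
Qed.

(** A homothetic copy in the body at time m is shrunk by the factor s towards a
    point of the body at time 0. *)
Lemma path_body_star s m : 0 <= s <= 1 -> 0 <= m <= 1 ->
  s * inradius (path_body m) S <= inradius (path_body (s * m)) S.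
Proof.
move=> s01 m01; have /andP[s0 s1] := s01; have [X1 _ _] := path_body0_vertices.
have scaled t rho : 0 <= rho -> homothet t rho S `<=` path_body m ->
    s * rho <= inradius (path_body (s * m)) S.
  move=> rho0 tK; pose x1 := vertex_comb F 0 (1 - a) a.
  apply: (@inradius_ge _ _ F _ (1 + d) ((1 - s) *: x1 + s *: t)).
  - exact: path_body_spread.
  - exact: mulr_ge0.
  move=> _ [y Sy <-]; rewrite -addrA -scalerA -scalerDr.
  by apply: path_body_scale => //; apply: tK; exists y.
have [->|sN0] := eqVneq s 0.
  rewrite !mul0r.
  apply: (@inradius_ge _ _ F _ (1 + d) (vertex_comb F 0 (1 - a) a)) => //.
    exact: path_body_spread.
  exact: point_homothet.
have sgt0 : 0 < s by rewrite lt_neqAle eq_sym sN0.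
rewrite mulrC -ler_pdivlMr//; apply: inradius_le => [|t rho rho0 tK].
  by have [[]] := path_body_nontrivial m01.
by rewrite ler_pdivlMr// mulrC; exact: scaled tK.
Qed.

Lemma path_body0_inradius : f <= inradius (path_body 0) S.
Proof.
have [A B C] := low_triangle_bounds.
have [X1 X2 X3] := path_body0_vertices.
have f0 : 0 <= f by exact: low_triangle_f_ge0.
apply: (inradius_ge (@path_body_spread 0) f0).
have := @inscribed_homothet _ _ F (path_body 0) _ _ _ 0 1 a b c
  (@moving_polygon_convex _ _ _) X1 X2 X3 A B C.
rewrite !add0r !scale1r mul1r; exact.
Qed.

Lemma path_body1_inradius : h <= inradius (path_body 1) S.
Proof.
have [[/andP[d0 d1] _ _ _ _] _ _ _ _] := low.
have h0 : 0 <= h by rewrite /h; lra.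
apply: (inradius_ge (@path_body_spread 1) h0 (t := 0)).
move=> x /(homothetP F _ _ h0); rewrite !dot0r !subr0 /h => -[k1 k2 k3].
have s := normals_dot_sum F x.
by apply: path_body1; rewrite ?/h; lra.
Qed.

(** Apply the i-th cofactor constraint to the i-th vertex of a copy of ratio
    rho inside the body. The columns of the cofactor matrix sum to f, so the
    translation drops out when the three inequalities are added, leaving
    0 <= f - rho + 3 l. *)
Lemma path_body_inradius_le l : 0 <= l <= 1 ->
  inradius (path_body l) S <= f + 3 * l.
Proof.
move=> l01; apply: inradius_le => [|t rho rho0 tK].
  by have [[]] := path_body_nontrivial l01.
have vertexP v : S v -> path_body l (t + rho *: v).
  by move=> Sv; apply: tK; exists v.
have [/vertexP V1 /vertexP V2 /vertexP V3] := vertices_mem F.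
move: V1 V2 V3 => /path_bodyP[_ _ _ [k1 _ _]] /path_bodyP[_ _ _ [_ k2 _]].
move=> /path_bodyP[_ _ _ [_ _ k3]]; move: k1 k2 k3; rewrite !dotE.
have [-> -> ->] := dual1 F; have [-> -> ->] := dual2 F.
have [-> -> ->] := dual3 F.
have := normals_dot_sum F t.
set T1 := dot n1 t; set T2 := dot n2 t; set T3 := dot n3 t => Ts k1 k2 k3.
have T3E : T3 = - T1 - T2 by lra.
have := addr_ge0 (addr_ge0 k1 k2) k3; rewrite T3E.
set Z := (X in 0 <= X -> _).
have -> : Z = f - rho + 3 * l by rewrite /Z /f; field.
by lra.
Qed.

Lemma path_body_attains x : f <= x -> x <= h ->
  exists2 K, nontrivial_convex_body K & f_max S K = (x, h).
Proof.
move=> fx xh.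
have [l l01 lx] := @star_intermediate_value R
  (fun l => inradius (path_body l) S) f 3 x path_body_star path_body_inradius_le
  low_triangle_f_ge0 path_body0_inradius ltac:(lra) fx
  (le_trans xh path_body1_inradius).
exists (path_body l); first exact: path_body_nontrivial.
rewrite /f_max path_body_circumradius// path_body_diameter// lx.
by rewrite divr1 mulr1.
Qed.

End Realization.

Theorem theorem4p12 (R : realType) (S : set 'rV[R]_2)
    (S_triangle : triangle S) (S_centered : minkowski_centered S) :
  (forall K : set 'rV[R]_2, nontrivial_convex_body K ->
    [/\ diameter_max K S / 2 <= circumradius K S,
        inradius K S <= diameter_max K S / 2,
        0 <= inradius K S,
        circumradius K S <= diameter_max K S &
        (diameter_max K S / circumradius K S - 1 / 2) *
        (3 / 2 - diameter_max K S / circumradius K S)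
          <= inradius K S / circumradius K S]) /\
  max_diagram S =
    [set p : R * R |
      [/\ p.2 <= 1, p.1 <= p.2, 0 <= p.1, 1 <= 2 * p.2 &
          (2 * p.2 - 1 / 2) * (3 / 2 - 2 * p.2) <= p.1]].
Proof.
have [F] := centered_frame_exists S_triangle S_centered.
split; first exact: (body_inequalities F).
apply/seteqP; split=> [_ [K bK <-]|[x y] /= [y1 xy x0 y0 xlow]].
  have [i1 i2 i3 i4 i5] := body_inequalities F bK.
  have R0 := circumradius_gt0 F bK; rewrite /f_max /=.
  have -> : diameter_max K S / (2 * circumradius K S) =
      (diameter_max K S / circumradius K S) / 2.
    by field; rewrite gt_eqF.
  have d2 : diameter_max K S / circumradius K S <= 2.
    by rewrite ler_pdivrMr//; lra.
  have d1 : 1 <= diameter_max K S / circumradius K S.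
    by rewrite ler_pdivlMr//; lra.
  have rd : inradius K S / circumradius K S <=
      (diameter_max K S / circumradius K S) / 2.
    by rewrite mulrAC ler_pM2r ?invr_gt0.
  have r0 : 0 <= inradius K S / circumradius K S by rewrite divr_ge0 ?(ltW R0).
  rewrite [2 * (_ / 2)]mulrC divfK ?gt_eqF ?ltr0n//.
  by split=> //; lra.
pose d := 2 * y - 1.
have hE : (1 + d) / 2 = y by rewrite /d; lra.
(* The lower boundary: the inscribed triangle has inradius 1/4 - d^2 up to
   d = 1/2, where it degenerates to a segment; from there on segments
   of inradius 0 take over. *)
have [dhalf|dhalf] := leP d (1 / 2).
  have low : low_triangle (1 / 2 - d) (1 / 2) (1 / 2 + d) d.
    rewrite /low_triangle hE /d in dhalf *.
    by do !split; try (apply/andP; split); lra.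
  have := path_body_attains F low (x := x); rewrite hE => -[||K bK KE] //.
    by move: xlow; rewrite /d; nra.
  by exists K.
have low : low_triangle 0 d 1 d.
  rewrite /low_triangle hE /d in dhalf *.
  by do !split; try (apply/andP; split); lra.
have := path_body_attains F low (x := x); rewrite hE => -[||K bK KE] //.
  by lra.
by exists K.
Qed.
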